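(* Let $m\ge 2$, let $G = Q_{4m} = \langle x, y : x^{2m} = 1,\ x^m = y^2,\ y^{-1}xy = x^{-1}\rangle$, and let $\mathcal{CCC}(G)$ be its commuting conjugacy class graph. Then: (1) $$\mathrm{Spec}(\mathcal{CCC}(G)) = \begin{cases}\left\{(-1)^{m - 1}, 1^{1}, (m - 2)^{1}\right\}, & \text{if } m \text{ is odd},\\ \left\{(-1)^{m - 2}, 0^{2}, (m - 2)^{1}\right\}, & \text{if } m \text{ is even},\end{cases}$$ and $$E(\mathcal{CCC}(G)) = \begin{cases}2m - 2, & \text{if } m \text{ is odd},\\ 2m - 4, & \text{if } m \text{ is even}.\end{cases}$$ (2) $$\mathrm{L\text{-}Spec}(\mathcal{CCC}(G)) = \begin{cases}\left\{0^{2}, 2^1, (m - 1)^{m - 2}\right\}, & \text{if } m \text{ is odd},\\ \left\{0^{3}, (m - 1)^{m - 2}\right\}, & \text{if } m \text{ is even},\end{cases}$$ and $$LE(\mathcal{CCC}(G)) = \begin{cases}4, & \text{if } m = 3,\\ \frac{2(m - 2)(3m - 5)}{m + 1}, & \text{if } m \text{ is odd and } m \geq 5,\\ \frac{6(m - 1)(m - 2)}{m + 1}, & \text{if } m \text{ is even}.\end{cases}$$ (3) $$\mathrm{Q\text{-}Spec}(\mathcal{CCC}(G)) = \begin{cases}\left\{2^1, 0^{1}, (2m - 4)^{1}, (m - 3)^{m - 2}\right\}, & \text{if } m \text{ is odd},\\ \left\{0^{2}, (2m - 4)^{1}, (m - 3)^{m - 2}\right\}, & \text{if } m \text{ is even},\end{cases}$$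 and $$LE^+(\mathcal{CCC}(G)) = \begin{cases}4, & \text{if } m = 3,\\ \frac{22}{3}, & \text{if } m = 5,\\ \frac{4(m - 1)(m - 3)}{m + 1}, & \text{if } m \text{ is odd and } m \geq 7,\\ \frac{2(m - 2)(m + 3)}{m + 1}, & \text{if } m = 2, 4,\\ \frac{4(m - 1)(m - 2)}{m + 1}, & \text{if } m \text{ is even and } m \geq 6.\end{cases}$$
   Context: For a finite non-abelian group $G$, the commuting conjugacy class graph $\mathcal{CCC}(G)$ is the simple undirected graph whose vertices are the conjugacy classes of the non-central elements of $G$; two distinct vertices $x^G$ and $y^G$ are adjacent iff there exist $x'\in x^G$ and $y'\in y^G$ with $x'y'=y'x'$. For a finite graph $\mathcal{G}$ with adjacency matrix $A(\mathcal{G})$ and (diagonal) degree matrix $D(\mathcal{G})$, put $L(\mathcal{G})=D(\mathcal{G})-A(\mathcal{G})$ and $Q(\mathcal{G})=D(\mathcal{G})+A(\mathcal{G})$. $\mathrm{Spec}(\mathcal{G})$, $\mathrm{L\text{-}Spec}(\mathcal{G})$, $\mathrm{Q\text{-}Spec}(\mathcal{G})$ are the multisets of eigenvalues of $A(\mathcal{G})$, $L(\mathcal{G})$, $Q(\mathcal{G})$ respectively. In the notation $\{\alpha_1^{a_1},\dots,\alpha_l^{a_l}\}$ the exponent is a multiplicity; if listed values coincide their multiplicities are added, and exponent $0$ means the value is absent. With $d=\frac{2|e(\mathcal{G})|}{|V(\mathcal{G})|}$ ($|V(\mathcal{G})|$ the number of vertices, $|e(\mathcal{G})|$ the number of edges),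 the energy, Laplacian energy and signless Laplacian energy (sums with multiplicity) are $E(\mathcal{G})=\sum_{\lambda\in \mathrm{Spec}(\mathcal{G})}|\lambda|$, $LE(\mathcal{G})=\sum_{\mu\in \mathrm{L\text{-}Spec}(\mathcal{G})}|\mu-d|$, $LE^+(\mathcal{G})=\sum_{\nu\in \mathrm{Q\text{-}Spec}(\mathcal{G})}|\nu-d|$. *)

(* Defs.v *)
From HB Require Import structures.
From mathcomp Require Import all_boot all_order all_algebra.
From mathcomp Require Import all_fingroup all_solvable.
Set Implicit Arguments.
Unset Strict Implicit.
Unset Printing Implicit Defensive.
Import Order.TTheory GRing.Theory Num.Theory.

Record sgraph := SGraph {
  vertex : finType;
  adj : rel vertex;
  adj_sym : symmetric adj;
  adj_irr : irreflexive adj }.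

Section CCCGraph.
Variables (gT : finGroupType) (G : {group gT}).
Local Open Scope group_scope.

Definition ncclasses : {set {set gT}} := [set x ^: G | x in G :\: 'Z(G)].

Definition ccc_vertex : finType := {C : {set gT} | C \in ncclasses}.

Definition ccc_adj : rel ccc_vertex := fun u v =>
  (u != v) && [exists x in val u, exists y in val v, x * y == y * x].

Lemma ccc_adj_sym : symmetric ccc_adj.
Proof.
suff H u v : ccc_adj u v -> ccc_adj v u by move=> u v; apply/idP/idP; apply: H.
rewrite /ccc_adj eq_sym => /andP[-> /exists_inP[x ux /exists_inP[y vy]]].
rewrite eq_sym => e; apply/exists_inP; exists y => //.
by apply/exists_inP; exists x.
Qed.

Lemma ccc_adj_irr : irreflexive ccc_adj.
Proof. by move=> u; rewrite /ccc_adj eqxx. Qed.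

Definition CCC : sgraph := SGraph ccc_adj_sym ccc_adj_irr.

End CCCGraph.

Section GraphSpectra.
Variables (C : numClosedFieldType) (g : sgraph).
Local Open Scope ring_scope.

Definition edges : {set {set vertex g}} :=
  [set e | [exists u, exists v, adj u v && (e == [set u; v])]].

Definition degree (u : vertex g) : nat := #|[set v | adj u v]|.

Definition adjmx : 'M[C]_#|vertex g| :=
  \matrix_(i, j) (adj (enum_val i) (enum_val j))%:R.

Definition degmx : 'M[C]_#|vertex g| :=
  diag_mx (\row_i (degree (enum_val i))%:R).

Definition lapmx : 'M[C]_#|vertex g| := degmx - adjmx.

Definition slapmx : 'M[C]_#|vertex g| := degmx + adjmx.

(* Eigenvalues with multiplicity, i.e. the roots of the characteristic
   polynomial; the order of the list is unspecified, so that multisets of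
   eigenvalues are to be compared with perm_eq. *)
Definition eigenvalues n (A : 'M[C]_n) : seq C :=
  sval (closed_field_poly_normal (char_poly A)).

Definition Spec : seq C := eigenvalues adjmx.
Definition LSpec : seq C := eigenvalues lapmx.
Definition QSpec : seq C := eigenvalues slapmx.

Definition avg_degree : C := 2 * #|edges|%:R / #|vertex g|%:R.

Definition energy : C := \sum_(l <- Spec) `|l|.
Definition Lenergy : C := \sum_(mu <- LSpec) `|mu - avg_degree|.
Definition Qenergy : C := \sum_(nu <- QSpec) `|nu - avg_degree|.

End GraphSpectra.

(* Main.v *)
Require Import Defs.
From HB Require Import structures.
From mathcomp Require Import all_boot all_order all_algebra.
From mathcomp Require Import all_fingroup all_solvable.
From mathcomp Require Import ring zify.
Import Order.TTheory GRing.Theory Num.Theory.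
Local Open Scope ring_scope.

(** Q_4m is the union of the cyclic group <x> of order 2m and the coset <x>y.
    Its non-central classes are {x^i, x^-i} for 0 < i < m and the classes of y
    and xy, which split <x>y by the parity of the exponent of x. Elements x^i y
    and x^j y commute iff i = j mod m, and a non-central power of x never
    commutes with an element of <x>y; so the graph is a clique on m - 1
    vertices together with an edge (m odd) or two isolated vertices (m even).
    Each of A, L and Q is then block diagonal with blocks a I + b J, whose
    characteristic polynomials are explicit. *)

(** * Classes and commutation in the dicyclic group *)

Section Dicyclic.
Set Implicit Arguments.
Unset Strict Implicit.
Local Open Scope group_scope.

(* The presentation only bounds the order from above; the order 4m is realised
   by the semidirect product Z_2m >| Z_4, of order 8m, modulo u^m v^2. *)
Lemma dicyclic_model (m : nat) : (1 < m)%N ->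
  exists gT : finGroupType, exists2 G : {group gT}, (4 * m <= #|G|)%N &
    G \homg Grp (x : y : x ^+ (2 * m)%N, x ^+ m = y ^+ 2, y^-1 * x * y = x^-1).
Proof.
move=> m_gt1; have q_gt1 : (1 < 2 * m)%N by rewrite mul2n -addnn ltn_addl.
have := isoGrp_hom (Grp_ext_dihedral q_gt1 (isT : (1 < 4)%N) (isT : 2 %| 4)%N).
have := card_ext_dihedral q_gt1 (isT : (1 < 4)%N) (isT : 2 %| 4)%N.
move: (Extremal.gtype _ _ _) => hT.
move=> oB /existsP[[u v]] /= /eqP[defB u2m v4 uv].
have uv2 : commute u (v ^+ 2).
  by apply/commgP/conjg_fixP; rewrite conjgM uv conjVg uv invgK.
(* Both generators fix [z] and its order is at most 2, so factoring it out keeps at least half of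
   the 8m elements. *)
set z := u ^+ m * v ^+ 2.
have um : (u ^+ m)^-1 = u ^+ m.
  by apply/eqP; rewrite eq_invg_mul -expgD addnn -mul2n u2m.
have zu : z ^ u = z.
  by apply/conjg_fixP/commgP/commute_sym/commuteM => //; apply: commuteX.
have zv : z ^ v = z.
  rewrite conjMg conjXg uv expgVn um conjXg.
  by congr (_ * _ ^+ 2); apply/conjg_fixP/commgP.
have z2 : z ^+ 2 = 1.
  rewrite expgMn; last by apply/commute_sym/commuteX/commute_sym.
  by rewrite -!expgM mulnC u2m mul1g.
have nZ : [set: hT] \subset 'N(<[z]>).
  by rewrite -defB join_subG !norms_cycle zu zv cycle_id.
have nu : u \in 'N(<[z]>) by rewrite (subsetP nZ) ?inE.
have nv : v \in 'N(<[z]>) by rewrite (subsetP nZ) ?inE.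
exists (coset_of <[z]>), ([set: hT] / <[z]>)%G.
  have oZ : (#[z] <= 2)%N by rewrite dvdn_leq // order_dvdn z2.
  have := Lagrange (subsetT <[z]>).
  rewrite -card_quotient // oB -mul2n => e.
  rewrite -(leq_pmul2l (isT : 0 < 2)%N) (_ : 2 * (4 * m) = 4./2 * (2 * (2 * m)))%N.
    by rewrite -e leq_mul2r oZ orbT.
  by rewrite !mulnA.
apply/existsP; exists (coset <[z]> u, coset <[z]> v) => /=.
rewrite -!quotient_cycle // -quotientY ?cycle_subG //= defB !xpair_eqE eqxx /=.
rewrite -!morphX -?morphV -?morphM ?groupM ?groupV //=.
rewrite u2m morph1 -mulgA -conjgE uv !eqxx /= andbT.
(* Left multiplication by [z] does not change the coset of [v ^+ 2], and z v^2 = u^m v^4 = u^m. *)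
rewrite -(coset_kerl (v ^+ 2) (cycle_id z)) -mulgA -expgD v4.
by rewrite mulg1.
Qed.

(** The relations bound the order of [a] by 2m and cover G by <a> and <a>b. The model is a
    homomorphic image of G, so |G| >= 4m, which forces equality for [a] and keeps [b] out of <a>. *)
Lemma dicyclic_gens (m : nat) (gT : finGroupType) (G : {group gT}) :
    (1 < m)%N ->
    G \isog Grp (x : y : x ^+ (2 * m)%N, x ^+ m = y ^+ 2,
                         y^-1 * x * y = x^-1) ->
  exists a b, [/\ <[a]> <*> <[b]> = G, #[a] = (2 * m)%N, b ^+ 2 = a ^+ m,
                  a ^ b = a^-1 & b \notin <[a]>].
Proof.
move=> m_gt1 isoG; have := isoGrp_hom isoG.
case/existsP=> -[a b] /= /eqP[defG a2m amb ab].
have {}ab : a ^ b = a^-1 by rewrite conjgE mulgA.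
have le_oa : (#[a] <= 2 * m)%N.
  by rewrite dvdn_leq ?order_dvdn ?a2m // muln_gt0 /= ltnW.
have leG : (4 * m <= #|G|)%N.
  have [hT [H leH homH]] := dicyclic_model m_gt1.
  by rewrite (leq_trans leH) // dvdn_leq ?card_homg // isoG.
have nab : <[b]> \subset 'N(<[a]>) by rewrite norms_cycle ab groupV cycle_id.
have nb : b \notin <[a]>.
  apply/negP; rewrite -cycle_subG => /joing_idPl eG.
  have := leq_trans leG; rewrite -defG eG => /(_ _ le_oa).
  by rewrite leq_pmul2r // ltnW.
have sG : G \subset <[a]> :|: <[a]> :* b.
  rewrite -defG norm_joinEr //; apply/subsetP => _ /mulsgP[x _ ax /cycleP[j ->] ->].
  rewrite -(odd_double_half j) addnC -mul2n expgD expgM -amb -expgM mulgA.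
  set y := x * _; have ay : y \in <[a]> by rewrite groupM ?mem_cycle.
  by case: (odd j); rewrite inE ?mulg1 ?ay // mem_rcoset mulgK ay orbT.
exists a, b; split=> //; apply/eqP; rewrite eqn_leq le_oa /=.
have := leq_trans leG (subset_leq_card sG).
move/leq_trans/(_ (leq_card_setU _ _)); rewrite card_rcoset -/(#[a]) addnn -mul2n.
have -> : (4 * m = 2 * (2 * m))%N by rewrite mulnA.
by rewrite leq_pmul2l.
Qed.

(** * Conjugacy classes of the dicyclic group and their adjacency *)

Section ClassGraph.
Variables (m : nat) (gT : finGroupType) (G : {group gT}) (a b : gT).
Hypotheses (m_gt1 : (1 < m)%N) (defG : <[a]> <*> <[b]> = G).
Hypotheses (oa : #[a] = (2 * m)%N) (b2 : b ^+ 2 = a ^+ m).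
Hypotheses (ab : a ^ b = a^-1) (nb : b \notin <[a]>).

Let m_gt0 : (0 < m)%N. Proof. exact: ltnW. Qed.
Let a2m : a ^+ (2 * m) = 1. Proof. by rewrite -oa expg_order. Qed.

Let aG : a \in G. Proof. by rewrite -defG (subsetP (joing_subl _ _)) ?cycle_id. Qed.
Let bG : b \in G. Proof. by rewrite -defG (subsetP (joing_subr _ _)) ?cycle_id. Qed.

Lemma dicyclic_memP x :
  x \in G -> exists i, x = a ^+ i \/ x = a ^+ i * b.
Proof.
have nab : <[b]> \subset 'N(<[a]>) by rewrite norms_cycle ab groupV cycle_id.
rewrite -defG norm_joinEr // => /mulsgP[_ _ /cycleP[i ->] /cycleP[j ->] ->].
rewrite -(odd_double_half j) addnC -mul2n expgD expgM b2 -expgM mulgA -expgD.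
exists (i + m * j./2)%N.
by case: (odd j); rewrite ?mulg1; [right | left].
Qed.

(** Natural exponents turn identities between powers of [a] into arithmetic that [ring] can
    settle. *)
Lemma dicyclic_expVg i : (a ^+ i)^-1 = a ^+ (i * (2 * m).-1).
Proof.
rewrite mulnC expgM -expgVn; congr (_ ^+ i).
by apply/eqP; rewrite eq_invg_mul -expgS prednK ?a2m // muln_gt0.
Qed.

Lemma dicyclic_conj_b i : (a ^+ i) ^ b = (a ^+ i)^-1.
Proof. by rewrite conjXg ab expgVn. Qed.

Lemma dicyclic_conj_ab i k : (a ^+ i) ^ (a ^+ k * b) = (a ^+ i)^-1.
Proof.
rewrite conjgM -dicyclic_conj_b; congr (_ ^ b).
by apply/conjg_fixP/commgP/commuteX2.
Qed.

Lemma dicyclic_swap i : b * a ^+ i = (a ^+ i)^-1 * b.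
Proof.
by rewrite [RHS]conjgC conjVg dicyclic_conj_b invgK.
Qed.

Lemma dicyclic_conj_power i x :
  x \in (a ^+ i) ^: G -> x = a ^+ i \/ x = (a ^+ i)^-1.
Proof.
case/imsetP=> g /dicyclic_memP[k [] -> ->]; last by right; exact: dicyclic_conj_ab.
by left; apply/conjg_fixP/commgP/commuteX2.
Qed.

(** Conjugation by [a ^+ j] shifts the exponent by -2j and conjugation by [b] negates it, so its
    parity is preserved. *)
Lemma dicyclic_conj_coset i x :
  x \in (a ^+ i * b) ^: G -> exists k, x = a ^+ (i + 2 * k) * b.
Proof.
have conja j : (a ^+ i * b) ^ (a ^+ j) = a ^+ (i + 2 * (j * (2 * m).-1)) * b.
  rewrite conjgE -!mulgA dicyclic_swap dicyclic_expVg !mulgA -!expgD.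
  by congr (a ^+ _ * b); ring.
case/imsetP=> g /dicyclic_memP[j [] -> ->]; rewrite ?conjgM conja.
  by exists (j * (2 * m).-1)%N.
rewrite conjMg dicyclic_conj_b (conjgE b b) mulKg dicyclic_expVg.
(* Put J = j(2m - 1). The exponent i + 2J gets multiplied by 2m - 1 = 2(m - 1) + 1, and the witness
   is J + (m - 1)(i + 2J). *)
exists ((2 * (j * (2 * m).-1)) * m.-1 + j * (2 * m).-1 + i * m.-1)%N.
congr (a ^+ _ * b).
by have -> : ((2 * m).-1 = m.-1 + m.-1 + 1)%N by [lia]; ring.
Qed.

(** Powers of [a] shift the exponent by any even amount, so <a>b has no classes beyond those of b
    and ab. *)
Lemma dicyclic_mem_coset i : a ^+ i * b \in (a ^+ (odd i) * b) ^: G.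
Proof.
apply/imsetP; exists (a ^+ i./2)^-1; first by rewrite groupV groupX.
rewrite conjgE invgK -(mulgA _ b) -dicyclic_conj_b -conjgC !mulgA -!expgD.
by congr (a ^+ _ * b); rewrite -{1}(odd_double_half i) -addnn; ring.
Qed.

(** The two products are a^(k - l) b^2 and a^(l - k) b^2; they agree exactly when a^(2k) = a^(2l),
    and [a] has order 2m. *)
Lemma dicyclic_coset_commute k l :
  (a ^+ k * b * (a ^+ l * b) == a ^+ l * b * (a ^+ k * b)) = (k == l %[mod m]).
Proof.
have E i j : a ^+ i * b * (a ^+ j * b) = a ^+ i * (a ^+ j)^-1 * b ^+ 2.
  by rewrite -!mulgA (mulgA b) dicyclic_swap -!mulgA.
rewrite !E (inj_eq (mulIg _)) -(inj_eq (mulIg (a ^+ (l + k)))).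
rewrite {1}expgD mulgA mulgKV addnC expgD mulgA mulgKV -!expgD !addnn -!mul2n.
by rewrite eq_expg_mod_order oa -!muln_modr eqn_pmul2l.
Qed.

(** Elements of <a>b invert x, so commuting with one would give x^2 = 1; but 2i lies strictly
    between 0 and 2m. *)
Lemma dicyclic_power_coset_commute i x y :
    (0 < i < m)%N -> x \in (a ^+ i) ^: G -> y \in <[a]> :* b ->
  x * y != y * x.
Proof.
move=> /andP[i_gt0 i_lt] xi /rcosetP[_ /cycleP[k ->] ->].
have xV : x ^ (a ^+ k * b) = x^-1.
  by case/dicyclic_conj_power: xi => ->; rewrite ?conjVg dicyclic_conj_ab.
have x2 : x ^+ 2 != 1.
  have: a ^+ (i * 2) != 1.
    by rewrite -order_dvdn oa (mulnC i) dvdn_pmul2l // gtnNdvd.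
  by rewrite expgM; case/dicyclic_conj_power: xi => -> //; rewrite expgVn invg_eq1.
apply: contra x2 => /eqP e.
rewrite expgS expg1 -eq_invg_mul; apply/eqP.
by rewrite -xV conjgE e mulKg.
Qed.

Let pm (i : 'I_m.-1) : (i.+1 < m)%N.
Proof. by have := ltn_ord i; rewrite -ltnS prednK. Qed.

(** The shift makes the exponents run through 1, ..., m - 1; ['I_2] is a parity. The sum type
    anticipates the two diagonal blocks of the matrices. *)
Definition dicyclic_rep (s : 'I_m.-1 + 'I_2) : gT :=
  match s with inl i => a ^+ i.+1 | inr e => a ^+ e * b end.

Lemma dicyclic_rep_noncentral s : dicyclic_rep s \in G :\: 'Z(G).
Proof.
rewrite in_setD; apply/andP; split; last first.
  by case: s => i; rewrite ?groupM ?groupX.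
apply/negP => /centerP[_ c]; case: s c => i /= c.
  have := @dicyclic_power_coset_commute i.+1 _ b _ (class_refl _ _) (rcoset_refl _ _).
  by rewrite c // eqxx pm => /(_ isT).
(* Since 1 < m, the exponent 1 is admissible: [a] itself commutes with no element of <a>b. *)
have := @dicyclic_power_coset_commute 1 _ (a ^+ i * b) _ (class_refl _ _).
by rewrite mem_rcoset mulgK mem_cycle c // eqxx m_gt1 => /(_ isT isT).
Qed.

Definition dicyclic_class s : vertex (CCC G) :=
  exist (fun C => C \in ncclasses G) (dicyclic_rep s ^: G)
    (imset_f (fun x => x ^: G) (dicyclic_rep_noncentral s)).

Let coset_notin k : a ^+ k * b \notin <[a]>.
Proof. by rewrite groupMl ?mem_cycle. Qed.

Let classP s t : dicyclic_class s = dicyclic_class t ->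
  dicyclic_rep s \in dicyclic_rep t ^: G.
Proof. by move=> /(congr1 val) /= <-; apply: class_refl. Qed.

Let odd_eqmod n k l : ~~ odd n -> k = l %[mod n] -> odd k = odd l.
Proof. by move=> /negbTE en /(congr1 odd); rewrite !odd_mod. Qed.

Let odd_ord2 (e : 'I_2) : odd e = e :> nat.
Proof. by case: e => [[|[|]]]. Qed.

Lemma dicyclic_class_inj : injective dicyclic_class.
Proof.
move=> [i|i] [j|j] /classP /=.
- case/dicyclic_conj_power => /eqP.
    rewrite eq_expg_mod_order oa !modn_small ?(ltn_trans (pm _)) ?ltn_Pmull //.
    by move/eqP => [] /val_inj ->.
  (* Otherwise 2m would divide (i + 1) + (j + 1), which is positive and below 2m. *)
  rewrite eq_sym eq_invg_mul -expgD -order_dvdn oa gtnNdvd //.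
  by rewrite mul2n -addnn -addSn leq_add // ltnW.
- case/dicyclic_conj_coset => k e.
  by have := coset_notin (j + 2 * k); rewrite -e mem_cycle.
- by case/dicyclic_conj_power => e; have := coset_notin i; rewrite e ?groupV mem_cycle.
case/dicyclic_conj_coset => k /mulIg/eqP.
rewrite eq_expg_mod_order oa => /eqP/odd_eqmod.
rewrite oddM oddD oddM addbF => /(_ isT)/(congr1 nat_of_bool) eij.
by congr inr; apply: val_inj; rewrite -[LHS]odd_ord2 eij odd_ord2.
Qed.

Lemma dicyclic_class_surj u : exists s, dicyclic_class s = u.
Proof.
suff [s us]: exists s, dicyclic_rep s \in val u.
  exists s; apply: val_inj => /=.
  case: u us => _ /= /imsetP[x _ ->] /=; exact: class_eqP.
case: u => _ /= /imsetP[x /setDP[Gx nZx] ->] /=.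
have [i [] ex] := dicyclic_memP Gx; last first.
  exists (inr (inord (odd i))) => /=; rewrite inordK ?ltnS ?leq_b1 //.
  by rewrite ex class_sym dicyclic_mem_coset.
have ei : x = a ^+ (i %% (2 * m)) by rewrite ex -oa expg_mod_order.
have : (i %% (2 * m) < 2 * m)%N by rewrite ltn_mod muln_gt0.
move: (i %% _)%N ei => {ex} {}i ex lt_i.
(* A power of [a] that commutes with [b] commutes with every a^j and a^j b, hence is central. *)
have central : a ^+ i * b != b * a ^+ i.
  apply: contra nZx => /eqP e; apply/centerP; split=> // _ /dicyclic_memP[j [] ->].
    by rewrite ex; apply: commuteX2.
  by rewrite ex; apply: commuteM => //; apply: commuteX2.
have i0 : (0 < i)%N by case: i central {ex lt_i} => //; rewrite mul1g mulg1 eqxx.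
have [lt_im|lt_mi|e_im] := ltngtP i m.
- have lt_i1 : (i.-1 < m.-1)%N by rewrite -ltnS !prednK.
  by exists (inl (Ordinal lt_i1)); rewrite /= prednK // ex class_refl.
(* Past m, the representative is the inverse a^(2m - i), which [b] conjugates to a^i. *)
- have lt_i1 : ((2 * m - i).-1 < m.-1)%N by lia.
  exists (inl (Ordinal lt_i1)) => /=; apply/imsetP; exists b => //.
  rewrite ex dicyclic_conj_b; apply/eqP; rewrite eq_sym eq_invg_mul -expgD.
  by rewrite prednK ?subn_gt0 // subnKC ?a2m // ltnW.
(* Exponent m gives a^m = b^2, which commutes with [b]. *)
by case/eqP: central; rewrite e_im -b2 -expgS -expgSr.
Qed.

Lemma dicyclic_class_adj s t :
  adj (dicyclic_class s) (dicyclic_class t) =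
    (s != t) && match s, t with
                | inl _, inl _ => true | inr _, inr _ => odd m | _, _ => false
                end.
Proof.
rewrite /adj /= /ccc_adj (inj_eq dicyclic_class_inj).
have coset x e : x \in dicyclic_rep (inr e) ^: G -> x \in <[a]> :* b.
  by case/dicyclic_conj_coset => k ->; rewrite mem_rcoset mulgK mem_cycle.
have power (i : 'I_m.-1) : (0 < i.+1 < m)%N by rewrite pm.
have [<- //|neq] := eqVneq s t; rewrite /=.
case: s t neq => [i|e] [j|f] neq.
- apply/exists_inP; exists (a ^+ i.+1); first exact: class_refl.
  apply/exists_inP; exists (a ^+ j.+1); first exact: class_refl.
  exact/eqP/commuteX2.
- apply/negbTE/negP => /exists_inP[x xi /exists_inP[y /coset yf]].
  by apply/negP/(dicyclic_power_coset_commute (power i) xi yf).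
- apply/negbTE/negP => /exists_inP[x /coset xe /exists_inP[y yj]].
  by rewrite eq_sym; apply/negP/(dicyclic_power_coset_commute (power j) yj xe).
have odd_neq : odd e != odd f.
  apply: contra neq => /eqP/(congr1 nat_of_bool).
  by rewrite !odd_ord2 => /val_inj ->.
(* For m even, congruence modulo m preserves parity and separates the two classes. For m odd, a^e b
   commutes with a^(e + m) b, whose exponent has the other parity. *)
apply/exists_inP/idP => [[x /dicyclic_conj_coset[k ->]]|m_odd].
  case/exists_inP=> y /dicyclic_conj_coset[l ->].
  rewrite dicyclic_coset_commute; apply: contraTT => m_even.
  apply: contra odd_neq => /eqP/(odd_eqmod m_even).
  by rewrite !mul2n !oddD !odd_double !addbF => ->.
exists (a ^+ e * b); first exact: class_refl.
apply/exists_inP; exists (a ^+ (e + m) * b); last first.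
  by rewrite dicyclic_coset_commute modnDr.
have := dicyclic_mem_coset (e + m); rewrite oddD m_odd addbT.
by case: (odd e) (odd f) odd_neq (odd_ord2 f) => [] [] //= _ <-.
Qed.

End ClassGraph.

(** This is all that the spectral computation uses about G; the generators are hidden from here
    on. *)
Lemma dicyclic_CCC (m : nat) (gT : finGroupType) (G : {group gT}) :
    (1 < m)%N ->
    G \isog Grp (x : y : x ^+ (2 * m)%N, x ^+ m = y ^+ 2,
                         y^-1 * x * y = x^-1) ->
  exists2 f : 'I_m.-1 + 'I_2 -> vertex (CCC G), bijective f &
    forall s t, adj (f s) (f t) =
      (s != t) && match s, t with
                  | inl _, inl _ => true | inr _, inr _ => odd m | _, _ => false
                  end.
Proof.
move=> m_gt1 /(dicyclic_gens m_gt1)[a [b [defG oa b2 ab nb]]].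
have f_adj := dicyclic_class_adj m_gt1 defG oa b2 ab nb.
have f_inj := @dicyclic_class_inj m gT G a b m_gt1 defG oa b2 ab nb.
have f_surj := @dicyclic_class_surj m gT G a b m_gt1 defG oa b2 ab nb.
eexists; last exact: f_adj.
have [g gK] := fin_all_exists f_surj.
by exists g => // s; apply: f_inj.
Qed.

End Dicyclic.

(** * Spectra of the class graph *)

Section Spectra.
Set Implicit Arguments.
Unset Strict Implicit.

(** [U] adds all other rows to the first, and [V] subtracts the first column from the others; the
    result is block lower triangular. *)
Lemma det_scalar_const (R : comNzRingType) n (a b : R) :
  \det (a%:M + const_mx b : 'M_n.+1) = (a + b *+ n.+1) * a ^+ n.
Proof.
pose u : 'rV[R]_n := const_mx 1.
pose U : 'M_(1 + n) := block_mx 1%:M u 0 1%:M.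
pose V : 'M_(1 + n) := block_mx 1%:M (- u) 0 1%:M.
have dU : \det U = 1 by rewrite det_ublock !det1 mul1r.
have dV : \det V = 1 by rewrite det_ublock !det1 mul1r.
suff UMV : U *m (a%:M + const_mx b) *m V =
    block_mx (a + b *+ n.+1)%:M 0 (const_mx b) a%:M.
  have := congr1 determinant UMV.
  by rewrite !det_mulmx dU dV mul1r mulr1 det_lblock !det_scalar expr1.
have uc p : u *m (const_mx b : 'M_(n, p)) = const_mx (b *+ n).
  apply/matrixP => i j; rewrite !mxE (eq_bigr (fun=> b)) => [|k _].
    by rewrite sumr_const card_ord.
  by rewrite !mxE mul1r.
have cu p c : (const_mx c : 'M_(p, 1)) *m u = const_mx c.
  by apply/matrixP => i j; rewrite !mxE big_ord1 !mxE mulr1.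
rewrite -[const_mx b](@block_mx_const _ 1 n 1 n) (@scalar_mx_block _ 1 n a).
rewrite add_block_mx !mulmx_block.
rewrite !(mul1mx, mulmx1, mul0mx, mulmx0, add0r, addr0, mulmxDr, mulmxN, uc).
rewrite !mulmxDl !cu mul_scalar_mx mul_mx_scalar.
congr block_mx; apply/matrixP => i j; rewrite !mxE; try ring.
by rewrite !ord1 eqxx !mulr1n mulrS; ring.
Qed.

(** Changing the enumeration permutes rows and columns alike, and the two signs cancel. This frees
    the vertex order from [enum_val]. *)
Lemma char_poly_enum (R : comNzRingType) (T : finType) n (e : 'I_n -> T)
    (F : T -> T -> R) : bijective e ->
  char_poly (\matrix_(i, j) F (enum_val i) (enum_val j) : 'M_#|T|) =
  char_poly (\matrix_(i, j) F (e i) (e j) : 'M_n).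
Proof.
move=> bij_e; have en : n = #|T| by rewrite -(bij_eq_card bij_e) card_ord.
subst n; have e_inj := bij_inj bij_e.
pose s := perm (inj_comp enum_rank_inj e_inj).
set A := \matrix_(i, j) _; set B := \matrix_(i, j) _.
suff -> : char_poly B = \det (row_perm s (col_perm s (char_poly_mx A))).
  rewrite row_permE col_permE !det_mulmx !det_perm mulrC -mulrA odd_permV.
  by rewrite -signr_addb addbb mulr1.
congr determinant; apply/matrixP => i j.
by rewrite !mxE (inj_eq perm_inj) !permE /= !enum_rankK.
Qed.

(** The characteristic matrix is (X - a) I + (-b) J, so the determinant formula applies over the
    polynomial ring. *)
Lemma char_poly_scalar_const (R : comNzRingType) n (a b : R) :
  char_poly (a%:M + const_mx b : 'M_n.+1) =
  ('X - (a + b *+ n.+1)%:P) * ('X - a%:P) ^+ n.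
Proof.
have -> : 'X - (a + b *+ n.+1)%:P = ('X - a%:P) + (- b%:P) *+ n.+1.
  by rewrite polyCD opprD addrA polyCMn mulNrn.
rewrite -det_scalar_const; congr determinant; apply/matrixP => i j.
by rewrite !mxE polyCD polyCMn opprD addrA mulrnBl.
Qed.

Lemma eigenvalues_char_poly (F : numClosedFieldType) n (A : 'M[F]_n) (s : seq F) :
  char_poly A = \prod_(x <- s) ('X - x%:P) -> perm_eq (eigenvalues A) s.
Proof.
move=> eA; rewrite /eigenvalues; case: closed_field_poly_normal => r /= er.
by apply: prod_XsubC_eq; rewrite -eA [RHS]er (monicP (char_poly_monic A)) scale1r.
Qed.

(** Ordered adjacent pairs are counted by first vertex and by underlying edge; each edge carries the
    two pairs (u, v) and (v, u). *)
Lemma double_edges (g : sgraph) : (2 * #|edges g| = \sum_(u : vertex g) degree u)%N.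
Proof.
pose E := [set p : vertex g * vertex g | adj p.1 p.2].
have -> : (\sum_(u : vertex g) degree u)%N = #|E|.
  rewrite -sum1_card (eq_bigl (fun p => adj p.1 p.2)) => [|p]; last by rewrite inE.
  rewrite -(pair_big_dep xpredT _ (fun _ _ => 1%N)) /=; apply: eq_bigr => u _.
  by rewrite sum1_card; apply: eq_card => v; rewrite !inE.
rewrite -[RHS]sum1_card (partition_big (fun p => [set p.1; p.2]) (mem (edges g))) /=.
  rewrite mulnC -sum_nat_const; apply: eq_bigr => e.
  rewrite inE => /existsP[u /existsP[v /andP[uv /eqP ->]]].
  have neq_uv : u != v by apply: contraTneq uv => ->; rewrite adj_irr.
  rewrite sum1_card (_ : 2 = #|[set (u, v); (v, u)]|)%N; last first.
    by rewrite cards2 xpair_eqE (negbTE neq_uv).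
  apply: eq_card => -[x y]; rewrite !inE !xpair_eqE /= [in RHS]unfold_in /=.
  rewrite !inE.
  apply/idP/andP => /= [/orP[] /andP[/eqP -> /eqP ->] | [xy /eqP exy]].
  - by rewrite uv eqxx.
  - by rewrite adj_sym uv setUC eqxx.
  have /set2P[ex|ex] : x \in [set u; v] by rewrite -exy set21.
    have /set2P[ey|->] : y \in [set u; v] by rewrite -exy set22.
      by rewrite ex ey adj_irr in xy.
    by rewrite ex !eqxx.
  have /set2P[->|ey] : y \in [set u; v] by rewrite -exy set22.
    by rewrite ex !eqxx orbT.
  by rewrite ex ey adj_irr in xy.
move=> [x y]; rewrite !inE /= => xy.
by apply/existsP; exists x; apply/existsP; exists y; rewrite xy eqxx.
Qed.

(** * Spectra and energies of a clique together with a pair of vertices *)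

Section CliqueGraph.
(* The disjoint union of a clique on n + 1 vertices with either an edge or two
   isolated vertices, according to c. *)
Variables (F : numClosedFieldType) (g : sgraph) (n : nat) (c : bool).
Variable f : 'I_n.+1 + 'I_2 -> vertex g.
Hypothesis f_bij : bijective f.
Hypothesis f_adj : forall s t, adj (f s) (f t) =
  (s != t) && match s, t with
              | inl _, inl _ => true | inr _, inr _ => c | _, _ => false
              end.

Let f_inj : injective f. Proof. exact: bij_inj. Qed.

Lemma degree_clique s : degree (f s) = if s is inl _ then n else c.
Proof.
have -> : degree (f s) = (\sum_t adj (f s) (f t))%N.
  rewrite /degree -sum1_card big_mkcond (reindex f) /=; last exact: onW_bij.
  by apply: eq_bigr => t _; rewrite inE; case: (adj _ _).
rewrite big_sumType /=; case: s => s.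
  rewrite [X in (_ + X)%N]big1 => [|t _]; last by rewrite f_adj andbF.
  rewrite addn0 (bigD1 s) //= f_adj eqxx add0n (eq_bigr (fun=> 1%N)).
    by rewrite sum1_card; have := cardC1 s; rewrite card_ord.
  by move=> t; rewrite f_adj eq_sym (inj_eq inl_inj) => ->.
rewrite [X in (X + _)%N]big1 => [|t _]; last by rewrite f_adj andbF.
rewrite add0n (bigD1 s) //= f_adj eqxx add0n (eq_bigr (fun=> nat_of_bool c)).
  by rewrite sum_nat_const (eq_card (B := predC1 s)) // cardC1 card_ord mul1n.
by move=> t; rewrite f_adj eq_sym (inj_eq inr_inj) => ->.
Qed.

(** One computation serves A, L and Q: each has blocks a I + b J of sizes n + 1 and 2. *)
Lemma char_poly_clique (M : vertex g -> vertex g -> F) (a1 b1 a2 b2 : F) :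
    (forall s t, M (f s) (f t) = match s, t with
       | inl i, inl j => a1 *+ (i == j) + b1
       | inr i, inr j => a2 *+ (i == j) + b2
       | _, _ => 0 end) ->
  char_poly (\matrix_(i, j) M (enum_val i) (enum_val j) : 'M_#|vertex g|) =
  \prod_(x <- [:: a1 + b1 *+ n.+1; a2 + b2 *+ 2; a2] ++ nseq n a1) ('X - x%:P).
Proof.
(* Listing the clique first makes the matrix block diagonal. *)
move=> eM; have e_bij : bijective (f \o @split n.+1 2).
  by apply: bij_comp => //; exists (@unsplit _ _); [exact: splitK | exact: unsplitK].
rewrite (char_poly_enum _ e_bij).
have -> : (\matrix_(i, j) M ((f \o @split n.+1 2) i) ((f \o @split n.+1 2) j)) =
    block_mx (a1%:M + const_mx b1) 0 0 (a2%:M + const_mx b2).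
  apply/matrixP => i j; rewrite mxE /= eM -[i in RHS]splitK -[j in RHS]splitK.
  by case: (split i) (split j) => k [] l;
    rewrite /= ?block_mxEul ?block_mxEur ?block_mxEdl ?block_mxEdr !mxE.
rewrite /char_poly char_block_diag_mx det_ublock -!/(char_poly _).
rewrite !char_poly_scalar_const big_cat /= !big_cons big_nil big_nseq.
rewrite iter_mulr_1 expr1 mulr1 -!mulrA; congr (_ * _); ring.
Qed.

Lemma Spec_clique :
  perm_eq (Spec F g) ([:: n%:R; c%:R; - c%:R] ++ nseq n (-1)).
Proof.
apply: eigenvalues_char_poly.
(* The blocks are J - I and c (J - I). *)
rewrite /adjmx (char_poly_clique
  (M := fun u v => (adj u v)%:R) (a1 := -1) (b1 := 1) (a2 := - c%:R) (b2 := c%:R)).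
  congr (\prod_(x <- _ ++ _) _); congr [:: _; _; _].
    by rewrite -[n.+1]addn1 natrD; ring.
  by ring.
move=> s t; rewrite f_adj; case: s t => i [] j //=.
  by rewrite (inj_eq inl_inj) andbT; case: eqP => _ /=; ring.
by rewrite (inj_eq inr_inj); case: eqP => _ /=; ring.
Qed.

Lemma LSpec_clique :
  perm_eq (LSpec F g) ([:: 0; 0; 2 * c%:R] ++ nseq n n.+1%:R).
Proof.
apply: eigenvalues_char_poly.
have -> : lapmx F g = \matrix_(i, j)
    ((degree (enum_val i))%:R *+ (enum_val i == enum_val j)
     - (adj (enum_val i) (enum_val j))%:R).
  by apply/matrixP => i j; rewrite !mxE (inj_eq enum_val_inj).
(* The degrees n and c turn the blocks into (n + 1) I - J and 2c I - c J. *)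
rewrite (char_poly_clique
  (M := fun u v => (degree u)%:R *+ (u == v) - (adj u v)%:R)
  (a1 := n.+1%:R) (b1 := -1) (a2 := 2 * c%:R) (b2 := - c%:R)).
  congr (\prod_(x <- _ ++ _) _); congr [:: _; _; _].
    by ring.
  by ring.
move=> s t; rewrite f_adj degree_clique (inj_eq f_inj).
case: s t => i [] j //=; rewrite ?(inj_eq inl_inj) ?(inj_eq inr_inj).
- by case: eqP => _ /=; ring.
- by ring.
- by ring.
by case: eqP => _ /=; ring.
Qed.

Lemma QSpec_clique :
  perm_eq (QSpec F g) ([:: 2 * n%:R; 2 * c%:R; 0] ++ nseq n (n%:R - 1)).
Proof.
apply: eigenvalues_char_poly.
have -> : slapmx F g = \matrix_(i, j)
    ((degree (enum_val i))%:R *+ (enum_val i == enum_val j)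
     + (adj (enum_val i) (enum_val j))%:R).
  by apply/matrixP => i j; rewrite !mxE (inj_eq enum_val_inj).
(* Here the blocks are (n - 1) I + J and c J. *)
rewrite (char_poly_clique
  (M := fun u v => (degree u)%:R *+ (u == v) + (adj u v)%:R)
  (a1 := n%:R - 1) (b1 := 1) (a2 := 0) (b2 := c%:R)).
  congr (\prod_(x <- _ ++ _) _); congr [:: _; _; _].
    by ring.
  by ring.
move=> s t; rewrite f_adj degree_clique (inj_eq f_inj).
case: s t => i [] j //=; rewrite ?(inj_eq inl_inj) ?(inj_eq inr_inj).
- by case: eqP => _ /=; ring.
- by ring.
- by ring.
by case: eqP => _ /=; ring.
Qed.

Lemma avg_degree_clique :
  avg_degree F g = (n.+1 * n + 2 * c)%:R / (n + 3)%:R.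
Proof.
rewrite /avg_degree -natrM double_edges; congr (_%:R / _%:R).
  rewrite (reindex f) /=; last exact: onW_bij.
  under eq_bigr do rewrite degree_clique.
  by rewrite big_sumType /= !sum_nat_const !card_ord.
by rewrite -(bij_eq_card f_bij) card_sum !card_ord addn2 addn3.
Qed.

Lemma energy_clique : energy F g = 2 * n%:R + 2 * c%:R.
Proof.
rewrite /energy (perm_big _ Spec_clique) /= !big_cons big_nseq iter_addr_0.
by rewrite !normrN !normr_nat normr1; ring.
Qed.

Lemma Lenergy_clique (d := avg_degree F g) :
  Lenergy F g = 2 * `|d| + `|2 * c%:R - d| + n%:R * `|n.+1%:R - d|.
Proof.
rewrite /Lenergy (perm_big _ LSpec_clique) /= !big_cons big_nseq iter_addr_0.
by rewrite -/d !add0r normrN; ring.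
Qed.

Lemma Qenergy_clique (d := avg_degree F g) :
  Qenergy F g =
    `|2 * n%:R - d| + `|2 * c%:R - d| + `|d| + n%:R * `|n%:R - 1 - d|.
Proof.
rewrite /Qenergy (perm_big _ QSpec_clique) /= !big_cons big_nseq iter_addr_0.
by rewrite -/d !add0r normrN; ring.
Qed.

End CliqueGraph.

(** The order is only partial, so a sign is certified by writing the number, or its opposite, as a
    quotient of naturals. *)
Lemma ger0_norm_ratio (F : numFieldType) (p q : nat) (x : F) :
  x = p%:R / q%:R -> `|x| = p%:R / q%:R.
Proof. by move=> ->; rewrite ger0_norm ?divr_ge0 ?ler0n. Qed.

Lemma ler0_norm_ratio (F : numFieldType) (p q : nat) (x : F) :
  - x = p%:R / q%:R -> `|x| = p%:R / q%:R.
Proof. by rewrite -normrN; apply: ger0_norm_ratio. Qed.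

End Spectra.

(** * Multiplicity lists and closed forms of the energies, by parity and size of m *)

Theorem theorem3p2 (C : numClosedFieldType) (m : nat) (hm : (2 <= m)%N)
    (gT : finGroupType) (G : {group gT})
    (hG : (G \isog Grp (x : y : x ^+ (2 * m)%N, x ^+ m = y ^+ 2,
                                y^-1 * x * y = x^-1))%g) :
  [/\
    [/\ odd m ->
          perm_eq (Spec C (CCC G))
            (tally_seq [:: (-1, (m - 1)%N); (1, 1%N); (m%:R - 2, 1%N)]),
        ~~ odd m ->
          perm_eq (Spec C (CCC G))
            (tally_seq [:: (-1, (m - 2)%N); (0, 2%N); (m%:R - 2, 1%N)]),
        odd m -> energy C (CCC G) = 2 * m%:R - 2 &
        ~~ odd m -> energy C (CCC G) = 2 * m%:R - 4],
    [/\ odd m ->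
          perm_eq (LSpec C (CCC G))
            (tally_seq [:: (0, 2%N); (2, 1%N); (m%:R - 1, (m - 2)%N)]),
        ~~ odd m ->
          perm_eq (LSpec C (CCC G))
            (tally_seq [:: (0, 3%N); (m%:R - 1, (m - 2)%N)]),
        m = 3%N -> Lenergy C (CCC G) = 4,
        odd m -> (5 <= m)%N ->
          Lenergy C (CCC G) = 2 * (m%:R - 2) * (3 * m%:R - 5) / (m%:R + 1) &
        ~~ odd m ->
          Lenergy C (CCC G) = 6 * (m%:R - 1) * (m%:R - 2) / (m%:R + 1)] &
    [/\ odd m ->
          perm_eq (QSpec C (CCC G))
            (tally_seq [:: (2, 1%N); (0, 1%N); (2 * m%:R - 4, 1%N);
                           (m%:R - 3, (m - 2)%N)]),
        ~~ odd m ->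
          perm_eq (QSpec C (CCC G))
            (tally_seq [:: (0, 2%N); (2 * m%:R - 4, 1%N);
                           (m%:R - 3, (m - 2)%N)]) &
    [/\ m = 3%N -> Qenergy C (CCC G) = 4,
        m = 5%N -> Qenergy C (CCC G) = 22 / 3,
        odd m -> (7 <= m)%N ->
          Qenergy C (CCC G) = 4 * (m%:R - 1) * (m%:R - 3) / (m%:R + 1),
        m = 2%N \/ m = 4%N ->
          Qenergy C (CCC G) = 2 * (m%:R - 2) * (m%:R + 3) / (m%:R + 1) &
        ~~ odd m -> (6 <= m)%N ->
          Qenergy C (CCC G) = 4 * (m%:R - 1) * (m%:R - 2) / (m%:R + 1)]]].
Proof.
have [f f_bij f_adj] := dicyclic_CCC hm hG.
(* With m = n + 2 the clique has n + 1 vertices, and m and n have the same parity. *)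
move: (CCC G) f f_bij f_adj => g; case: m hm {hG} => [|[|n]] //= _ f f_bij f_adj.
rewrite negbK in f_adj *.
have mR : n.+2%:R = n%:R + 2 :> C by rewrite -addn2 natrD.
have S := Spec_clique C f_bij f_adj; have L := LSpec_clique C f_bij f_adj.
have Q := QSpec_clique C f_bij f_adj.
rewrite (energy_clique C f_bij f_adj) (Lenergy_clique C f_bij f_adj).
rewrite (Qenergy_clique C f_bij f_adj) (avg_degree_clique C f_bij f_adj).
rewrite mR.
have e0 : n%:R + 2 - 2 = n%:R :> C by ring.
have e1 : n%:R + 2 - 1 = n.+1%:R :> C by rewrite -[n.+1]addn1 natrD; ring.
have e2 : 2 * (n%:R + 2) - 4 = 2 * n%:R :> C by ring.
have e4 : n%:R + 2 + 1 = (n + 3)%:R :> C by ring.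
have e3 : n%:R + 2 - 3 = n%:R - 1 :> C by ring.
have [s1 s2] : (n.+2 - 1 = n.+1 /\ n.+2 - 2 = n)%N by split; lia.
rewrite e0 e1 e2 e3 e4 s1 s2.
have c1 : odd n -> nat_of_bool (odd n) = 1%N by move=> ->.
have c0 : ~~ odd n -> nat_of_bool (odd n) = 0%N by move/negbTE=> ->.
split.
- split=> [/c1 c|/c0 c|/c1 c|/c0 c].
  (* Comparing counts for every predicate also covers listed values that coincide. *)
  + rewrite (permPl S) c; apply/seq.permP => p.
    by rewrite /= !count_cat /= !count_nseq; ring.
  + rewrite (permPl S) c oppr0; apply/seq.permP => p.
    by rewrite /= !count_cat /= !count_nseq; ring.
  + by rewrite c; ring.
  by rewrite c; ring.
- split=> [/c1 c|/c0 c|[nk]|/c1 c n_ge|/c0 c]; rewrite ?c.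
  + rewrite (permPl L) c mulr1; apply/seq.permP => p.
    by rewrite /= !count_cat /= !count_nseq; ring.
  + rewrite (permPl L) c mulr0; apply/seq.permP => p.
    by rewrite /= !count_cat /= !count_nseq; ring.
  + rewrite nk; set d := _ / _.
    have d1 : d = 1 by rewrite /d divff ?pnatr_eq0.
    rewrite d1 normr1 (@ger0_norm_ratio _ 1 1 (_ * _ - _)) /=; last by field.
    by rewrite (@ger0_norm_ratio _ 1 1 (_ - _)); [field | field].
  (* From m = 5 on, d exceeds the eigenvalue 2, unlike at m = 3 where d = 1. The variable k = m - 5
     gives numerators with natural coefficients. *)
  + have [k nk] : exists k, n = (k + 3)%N by exists (n - 3)%N; lia.
    set d := _ / _.
    have -> : `|d| = ((k + 4) * (k + 3) + 2)%:R / (k + 6)%:R.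
      by apply: ger0_norm_ratio; rewrite /d nk; congr (_%:R / _%:R); ring.
    have -> : `|2 * 1%:R - d| = (k * k + 5 * k + 2)%:R / (k + 6)%:R.
      by apply: ler0_norm_ratio; rewrite /d nk; field; rewrite -!natrD pnatr_eq0 !addnS.
    have -> : `|n.+1%:R - d| = (3 * k + 10)%:R / (k + 6)%:R.
      by apply: ger0_norm_ratio; rewrite /d nk; field; rewrite -!natrD pnatr_eq0 !addnS.
    by rewrite nk; field; rewrite -!natrD pnatr_eq0 !addnS.
  + set d := _ / _.
    have -> : `|d| = (n.+1 * n)%:R / (n + 3)%:R.
      by apply: ger0_norm_ratio; rewrite /d addn0.
    have -> : `|2 * 0%:R - d| = (n.+1 * n)%:R / (n + 3)%:R.
      by apply: ler0_norm_ratio; rewrite /d; field; rewrite -!natrD pnatr_eq0 !addnS.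
    have -> : `|n.+1%:R - d| = (3 * n.+1)%:R / (n + 3)%:R.
      by apply: ger0_norm_ratio; rewrite /d; field; rewrite -!natrD pnatr_eq0 !addnS.
    by field; rewrite -!natrD pnatr_eq0 !addnS.
split=> [/c1 c|/c0 c|].
- rewrite (permPl Q) c mulr1; apply/seq.permP => p.
  by rewrite /= !count_cat /= !count_nseq; ring.
- rewrite (permPl Q) c mulr0; apply/seq.permP => p.
  by rewrite /= !count_cat /= !count_nseq; ring.
split=> [[nk]|[nk]|/c1 c n_ge|nk|/c0 c n_ge].
- rewrite nk; set d := _ / _.
  have d1 : d = 1 by rewrite /d divff ?pnatr_eq0.
  rewrite d1 normr1 (@ger0_norm_ratio _ 1 1 (2 * 1 - 1)); last by field.
  by rewrite (@ler0_norm_ratio _ 1 1 (1 - 1 - 1)); [field | field].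
- rewrite nk (_ : nat_of_bool (odd 3) = 1%N) //; set d := _ / _.
  have d1 : d = 7 / 3 by rewrite /d; field.
  rewrite d1 (@ger0_norm_ratio _ 7 3 (7 / 3)) //.
  rewrite (@ger0_norm_ratio _ 11 3 (2 * 3 - _)); last by field.
  rewrite (@ler0_norm_ratio _ 1 3 (2 * _ - _)); last by field.
  by rewrite (@ler0_norm_ratio _ 1 3 (3 - 1 - _)); field.
(* For n odd, n - 1 - d = (n - 5) / (n + 3), nonnegative exactly from m = 7 on. *)
- have [k nk] : exists k, n = (k + 5)%N by exists (n - 5)%N; lia.
  rewrite c; set d := _ / _.
  have -> : `|d| = ((k + 6) * (k + 5) + 2)%:R / (k + 8)%:R.
    by apply: ger0_norm_ratio; rewrite /d nk; congr (_%:R / _%:R); ring.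
  have -> : `|2 * n%:R - d| = (k * k + 15 * k + 48)%:R / (k + 8)%:R.
    by apply: ger0_norm_ratio; rewrite /d nk; field; rewrite -!natrD pnatr_eq0 !addnS.
  have -> : `|2 * 1%:R - d| = (k * k + 9 * k + 16)%:R / (k + 8)%:R.
    by apply: ler0_norm_ratio; rewrite /d nk; field; rewrite -!natrD pnatr_eq0 !addnS.
  have -> : `|n%:R - 1 - d| = k%:R / (k + 8)%:R.
    by apply: ger0_norm_ratio; rewrite /d nk; field; rewrite -!natrD pnatr_eq0 !addnS.
  by rewrite nk; field; rewrite -!natrD pnatr_eq0 !addnS.
(* For n = 0 there are no edges and every term vanishes; for n = 2, d = 6/5 exceeds n - 1. *)
- have {nk} [->|->] : n = 0%N \/ n = 2%N by lia.
    by rewrite mul0r !mulr0 !subr0 normr0 !addr0 /=; ring.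
  rewrite (_ : nat_of_bool (odd 2) = 0%N) //; set d := _ / _.
  have d1 : d = 6 / 5 by rewrite /d; field.
  rewrite d1 (@ger0_norm_ratio _ 6 5 (6 / 5)) //.
  rewrite (@ger0_norm_ratio _ 14 5 (2 * 2 - _)); last by field.
  rewrite (@ler0_norm_ratio _ 6 5 (2 * _ - _)); last by field.
  by rewrite (@ler0_norm_ratio _ 1 5 (2 - 1 - _)); field.
(* For n even, n - 1 - d = (n - 3) / (n + 3), which is positive from m = 6 on. *)
have [k nk] : exists k, n = (k + 4)%N by exists (n - 4)%N; lia.
rewrite c; set d := _ / _.
have -> : `|d| = (n.+1 * n)%:R / (n + 3)%:R.
  by apply: ger0_norm_ratio; rewrite /d addn0.
have -> : `|2 * n%:R - d| = (n * n + 5 * n)%:R / (n + 3)%:R.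
  by apply: ger0_norm_ratio; rewrite /d; field; rewrite -!natrD pnatr_eq0 !addnS.
have -> : `|2 * 0%:R - d| = (n.+1 * n)%:R / (n + 3)%:R.
  by apply: ler0_norm_ratio; rewrite /d; field; rewrite -!natrD pnatr_eq0 !addnS.
have -> : `|n%:R - 1 - d| = k.+1%:R / (n + 3)%:R.
  by apply: ger0_norm_ratio; rewrite /d nk; field; rewrite -!natrD pnatr_eq0 !addnS.
by rewrite nk; field; rewrite -!natrD pnatr_eq0 !addnS.
Qed.
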